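(* Let $r,p$ be positive integers, $B\subset\mathbb{R}^p\setminus\{\mathbf{0}_{1\times p}\}$ a finite set, $\Gamma=\{0,1\}^r$, $\Lambda\subseteq B^r$ nonempty, and $\Theta=\Gamma\otimes\Lambda=\{\theta=(\gamma,\lambda):\gamma\in\Gamma,\ \lambda\in\Lambda\}$. Let $\{\mathbb{P}_\theta:\theta\in\Theta\}$ be a statistical experiment with observation $\mathbf{X}$, and let $\psi$ be a function on $\Theta$ with values in a metric space with metric $d$. Then for any $s>0$ and any estimator $T$ of $\psi(\theta)$ based on an observation from the experiment $\{\mathbb{P}_\theta,\theta\in\Theta\}$, $$\max_{\theta\in\Theta}2^s\,\mathbb{E}_{\mathbf{X}|\theta}\,d^s(T,\psi(\theta))\ \ge\ \alpha\,\frac r2\,\min_{1\le i\le r}\big\|\bar{\mathbb{P}}_{i,0}\wedge\bar{\mathbb{P}}_{i,1}\big\|,$$ where $$\alpha=\min_{\{(\theta,\theta')\in\Theta^2:\ H(\gamma(\theta),\gamma(\theta'))\ge1\}}\frac{d^s(\psi(\theta),\psi(\theta'))}{H(\gamma(\theta),\gamma(\theta'))}.$$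
   Context: For $\theta=(\gamma,\lambda)\in\Theta$, $\gamma(\theta)=\gamma$ and $\gamma_i(\theta)$ is its $i$th coordinate. $H(\gamma,\gamma')=\sum_{i=1}^r|\gamma_i-\gamma_i'|$ is the Hamming distance. For $a\in\{0,1\}$ and $1\le i\le r$, $\Theta_{i,a}=\{\theta\in\Theta:\gamma_i(\theta)=a\}$, which has cardinality $2^{r-1}D_\Lambda$ with $D_\Lambda=\mathrm{Card}(\Lambda)$, and $\bar{\mathbb{P}}_{i,a}=\frac{1}{2^{r-1}D_\Lambda}\sum_{\theta\in\Theta_{i,a}}\mathbb{P}_\theta$. For distributions $\mathbb{P},\mathbb{Q}$ with densities $p,q$ with respect to a common dominating measure $\mu$, the total variation affinity is $\|\mathbb{P}\wedge\mathbb{Q}\|=\int\min(p,q)\,d\mu$. $\mathbb{E}_{\mathbf{X}|\theta}$ is expectation under $\mathbb{P}_\theta$; $T=T(\mathbf{X})$ takes values in the metric space. *)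

(* Defs.v *)
From HB Require Import structures.
From mathcomp Require Import all_boot all_order all_algebra.
From mathcomp Require Import finmap.
From mathcomp Require Import all_classical all_reals all_analysis.
From mathcomp Require Import measurable_realfun.

Set Implicit Arguments.
Unset Strict Implicit.
Unset Printing Implicit Defensive.

Import Order.TTheory GRing.Theory Num.Theory.
Import numFieldNormedType.Exports.

Local Open Scope classical_set_scope.
Local Open Scope ring_scope.
Local Open Scope charge_scope.
Local Open Scope ereal_scope.

Section tv_affinity.
Context d (X : measurableType d) (R : realType).

Section add_finite.
Variables P Q : {finite_measure set X -> \bar R}.

HB.instance Definition _ := Measure.on (measure_add P Q).

Let measure_add_fin : fin_num_fun (measure_add P Q).
Proof. by move=> A mA; rewrite measure_addE fin_numD !fin_num_measure. Qed.

HB.instance Definition _ :=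
  @Measure_isFinite.Build _ X _ (measure_add P Q) measure_add_fin.

End add_finite.

(* The dominating measure is P + Q; by tv_affinityE below, every other
   dominating measure and choice of densities gives the same value. *)
Definition tv_affinity (P Q : {finite_measure set X -> \bar R}) : \bar R :=
  let mu := measure_add P Q in
  \int[mu]_x Order.min ('d (charge_of_finite_measure P) '/d mu x)
                       ('d (charge_of_finite_measure Q) '/d mu x).

Definition is_density (mu : {measure set X -> \bar R})
    (P : set X -> \bar R) (p : X -> \bar R) :=
  mu.-integrable setT p /\
  forall A, measurable A -> P A = \int[mu]_(x in A) p x.

Let integrable_mine (mu : {measure set X -> \bar R}) (p q : X -> \bar R) :
  mu.-integrable setT p -> mu.-integrable setT q ->
  mu.-integrable setT (fun x => Order.min (p x) (q x)).
Proof.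
move=> ip iq; have [mp _] := integrableP _ _ _ ip.
have [mq _] := integrableP _ _ _ iq.
have := integrableD measurableT (integrable_abse ip) (integrable_abse iq).
apply: le_integrable => //; first exact: measurable_mine.
move=> x _ /=; rewrite [leRHS]gee0_abs ?adde_ge0//.
by rewrite /Order.min; case: ifP => _; rewrite ?leeDl ?leeDr.
Qed.

Let integral_split (mu : {measure set X -> \bar R}) (A : set X) f :
  measurable A -> mu.-integrable setT f ->
  \int[mu]_x f x = \int[mu]_(x in A) f x + \int[mu]_(x in ~` A) f x.
Proof.
move=> mA /integrableP[mf _]; rewrite -integral_setU ?setUv//.
- exact: measurableC.
- by apply/disj_setPCl.
Qed.

Let min_integral_le (mu : {measure set X -> \bar R})
    (P Q : set X -> \bar R) (p q : X -> \bar R) (A : set X) :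
  is_density mu P p -> is_density mu Q q -> measurable A ->
  \int[mu]_x Order.min (p x) (q x) <= P A + Q (~` A).
Proof.
move=> [ip Pp] [iq Qq] mA; have imin := integrable_mine ip iq.
have mcA := measurableC mA; rewrite (integral_split mA imin) Pp// Qq//.
by apply: leeD; apply: le_integral => //;
  try (by apply: integrableS imin); try (by apply: integrableS ip);
  try (by apply: integrableS iq); move=> x _; rewrite ge_min lexx ?orbT.
Qed.

Let min_integral_attained (mu : {measure set X -> \bar R})
    (P Q : set X -> \bar R) (p q : X -> \bar R) :
  is_density mu P p -> is_density mu Q q ->
  exists2 A, measurable A &
    \int[mu]_x Order.min (p x) (q x) = P A + Q (~` A).
Proof.
move=> [ip Pp] [iq Qq]; have imin := integrable_mine ip iq.
have [mp _] := integrableP _ _ _ ip; have [mq _] := integrableP _ _ _ iq.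
have mA : measurable [set x | p x <= q x].
  by rewrite -[X in measurable X]setTI; exact: measurable_lee.
have mcA := measurableC mA.
exists [set x | p x <= q x] => //.
rewrite (integral_split mA imin) Pp// Qq//; congr (_ + _).
  by apply: eq_integral => x /[!inE] /= pq; rewrite min_l.
by apply: eq_integral => x /[!inE] /= /negP; rewrite -ltNge => /ltW pq; rewrite min_r.
Qed.

Lemma tv_affinityE (P Q : {finite_measure set X -> \bar R})
    (mu : {measure set X -> \bar R}) (p q : X -> \bar R) :
  is_density mu P p -> is_density mu Q q ->
  tv_affinity P Q = \int[mu]_x Order.min (p x) (q x).
Proof.
move=> dp dq; rewrite /tv_affinity.
have rn (N : {finite_measure set X -> \bar R}) :
    (forall A, N A <= measure_add P Q A) ->
    is_density (measure_add P Q) N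
      ('d (charge_of_finite_measure N) '/d (measure_add P Q)).
  move=> NPQ; have dom : charge_of_finite_measure N `<< measure_add P Q.
    apply/null_content_dominatesP => A mA A0.
    by apply/eqP; rewrite -measure_le0 -A0; exact: NPQ.
  split; first exact: Radon_Nikodym_integrable.
  by move=> A mA; rewrite -Radon_Nikodym_integral.
have dP : is_density (measure_add P Q) P
    ('d (charge_of_finite_measure P) '/d (measure_add P Q)).
  by apply: rn => A; rewrite measure_addE leeDl.
have dQ : is_density (measure_add P Q) Q
    ('d (charge_of_finite_measure Q) '/d (measure_add P Q)).
  by apply: rn => A; rewrite measure_addE leeDr.
apply/eqP; rewrite eq_le; apply/andP; split.
  by have [A mA ->] := min_integral_attained dp dq; exact: min_integral_le.
by have [A mA ->] := min_integral_attained dP dQ; exact: min_integral_le.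
Qed.

End tv_affinity.

Section parameter_space.
Context (R : realType) (r p : nat) (B : {fset 'rV[R]_p}).
Variable Lambda : {fset {ffun 'I_r -> B}}.

Definition param : finType := ({ffun 'I_r -> bool} * Lambda)%type.

(* bool is coerced to nat, so that |a - b| is 0 or 1 here. *)
Definition hamming (g g' : {ffun 'I_r -> bool}) : R :=
  (\sum_(i < r) `|(g i)%:R - (g' i)%:R|)%R.

Definition param_slice (i : 'I_r) (a : bool) : {set param} :=
  [set t : param | t.1 i == a]%SET.

Lemma card_param_slice i a : #|param_slice i a| = (2 ^ r.-1 * #|` Lambda|)%N.
Proof.
pose F j : {pred bool} := if j == i then pred1 a else predT.
have -> : #|param_slice i a| = #|finset.setX [set g in family F] [set: Lambda]|%SET.
  apply: eq_card => -[g l]; rewrite !inE andbT /=.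
  apply/eqP/forallP => [gia j|/(_ i)]; rewrite /F; last by rewrite eqxx inE => /eqP.
  by case: eqP => [->|_]; rewrite ?inE ?gia.
rewrite cardsX cardsE cardsT card_family -cardfE; congr (_ * _)%N.
rewrite foldrE big_map big_enum /= (bigD1 i)//= /F eqxx card1 mul1n.
rewrite (eq_bigr (fun=> 2%N)) => [|j /negPf->]; last by rewrite card_bool.
by rewrite prod_nat_const cardC1 card_ord.
Qed.

Context d (X : measurableType d) (P : param -> probability X R).

Definition mixture (i : 'I_r) (a : bool) (A : set X) : \bar R :=
  ((2 ^ r.-1 * #|` Lambda|)%:R^-1)%:E * \sum_(t in param_slice i a) P t A.

Section mixture_measure.
Variables (i : 'I_r) (a : bool).

Let mixture0 : mixture i a set0 = 0.
Proof. by rewrite /mixture big1 ?mule0. Qed.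

Let mixture_ge0 A : 0 <= mixture i a A.
Proof. by rewrite mule_ge0 ?lee_fin ?invr_ge0// sume_ge0. Qed.

Let mixture_sigma_additive : semi_sigma_additive (mixture i a).
Proof.
move=> F mF tF mUF; rewrite [X in X @ \oo --> _](_ : _ = fun n =>
    ((2 ^ r.-1 * #|` Lambda|)%:R^-1)%:E *
    \sum_(t in param_slice i a) \sum_(0 <= k < n) P t (F k)); last first.
  apply/funext => n; rewrite exchange_big/= ge0_sume_distrr// => k _.
  exact: sume_ge0.
apply: cvgeZl => //; apply: cvg_nnesum => t _.
  by apply: nearW => n; exact: sume_ge0.
exact: measure_semi_sigma_additive.
Qed.

HB.instance Definition _ := isMeasure.Build _ _ _ (mixture i a)
  mixture0 mixture_ge0 mixture_sigma_additive.

Let mixture_fin : fin_num_fun (mixture i a).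
Proof.
move=> A mA; rewrite fin_numM//; apply/sum_fin_numP => t _ _.
exact: fin_num_measure.
Qed.

HB.instance Definition _ :=
  @Measure_isFinite.Build _ X _ (mixture i a) mixture_fin.

End mixture_measure.

Context (M : metricType R) (psi : param -> M) (s : R).

(* The default +oo is never reached when 0 < r and Lambda is nonempty. *)
Definition alpha : \bar R :=
  \big[Order.min/+oo]_(tt : param * param | (1 <= hamming tt.1.1 tt.2.1)%R)
    (mdist (psi tt.1) (psi tt.2) `^ s / hamming tt.1.1 tt.2.1)%:E.

End parameter_space.

(* Borel measurability of an M-valued statistic. *)
Definition estimator d (X : measurableType d) (R : realType) (M : metricType R)
    (T : X -> M) :=
  forall U : set M, open U -> measurable (T @^-1` U).

(* Main.v *)
Require Import Defs.
From HB Require Import structures.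
From mathcomp Require Import all_boot all_order all_algebra.
From mathcomp Require Import finmap.
From mathcomp Require Import all_classical all_reals all_analysis.
From mathcomp Require Import measurable_realfun.

Set Implicit Arguments.
Unset Strict Implicit.
Unset Printing Implicit Defensive.

Import Order.TTheory GRing.Theory Num.Theory.
Import numFieldNormedType.Exports.

Local Open Scope classical_set_scope.
Local Open Scope ring_scope.
Local Open Scope ereal_scope.

(** The estimator T is turned into an estimator of the parameter itself: let
    n(x) be a parameter whose image under psi is nearest to T x. By the
    triangle inequality d (psi (n x)) (psi t) <= 2 d (T x) (psi t), so
    2^s d^s (T, psi t) is at least d^s (psi n, psi t), hence at least alpha
    times the Hamming distance between the bits of n and of t
    ([nearest_loss_ge]). That distance counts the coordinates on which n errs,
    and taking expectations turns the count into a sum of error probabilities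
    ([risk_ge_errors]).

    The maximal risk is at least the average risk over all parameters. For a
    fixed coordinate i, averaging the error probabilities over the parameters
    gives half the sum of the two errors of the test A = {i-th bit of n is 1}
    between the mixtures over the slices i-th bit = 0 and i-th bit = 1
    ([sum_coordinate_errors]). No test has total error below the total
    variation affinity ([tv_affinity_le_test]), so each of the r coordinates
    contributes at least half the smallest affinity, which is the bound.

    The passage through probabilities needs the events {i-th bit of n is 1} to
    be measurable although ties between nearest parameters occur;
    [measurable_argmin] supplies a nearest-point selection for which they
    are. *)

(** * Testing and total variation affinity *)

(** On A the minimum of the densities is bounded by that of P, off A by that of
    Q; integrating gives the two errors of the test that decides for Q on A. *)
Lemma tv_affinity_le_test d (X : measurableType d) (R : realType)
    (P Q : {finite_measure set X -> \bar R}) (A : set X) :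
  measurable A -> tv_affinity P Q <= P A + Q (~` A).
Proof.
move=> mA; rewrite /tv_affinity; set mu := measure_add P Q.
have dominated (N : {finite_measure set X -> \bar R}) :
    (forall E, N E <= mu E) -> charge_of_finite_measure N `<< mu.
  move=> Nmu; apply/null_content_dominatesP => E mE E0.
  by apply/eqP; rewrite -measure_le0 -E0; exact: Nmu.
have dP : charge_of_finite_measure P `<< mu.
  by apply: dominated => E; rewrite /mu measure_addE leeDl.
have dQ : charge_of_finite_measure Q `<< mu.
  by apply: dominated => E; rewrite /mu measure_addE leeDr.
have ip := Radon_Nikodym_integrable dP; have iq := Radon_Nikodym_integrable dQ.
have mcA := measurableC mA.
have -> : P A = charge_of_finite_measure P A by [].
have -> : Q (~` A) = charge_of_finite_measure Q (~` A) by [].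
rewrite (Radon_Nikodym_integral dP mA) (Radon_Nikodym_integral dQ mcA).
set p := Radon_Nikodym _ _ in ip *; set q := Radon_Nikodym _ _ in iq *.
have [mp _] := integrableP _ _ _ ip; have [mq _] := integrableP _ _ _ iq.
(* Radon-Nikodym densities are nonnegative only almost everywhere, so the
   minimum is dominated by the sum of absolute values. *)
have imin : mu.-integrable setT (fun x => Order.min (p x) (q x)).
  apply: le_integrable
    (integrableD measurableT (integrable_abse ip) (integrable_abse iq)) => //.
    exact: measurable_mine.
  move=> x _ /=; rewrite [leRHS]gee0_abs ?adde_ge0//.
  by rewrite /Order.min; case: ifP => _; rewrite ?leeDl ?leeDr.
rewrite -{1}(setUv A) integral_setU//; last 2 first.
- by rewrite setUv; exact: measurable_mine.
- exact/disj_setPCl.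
apply: leeD; apply: le_integral => //.
- exact: integrableS imin.
- exact: integrableS ip.
- by move=> x _; rewrite ge_min lexx.
- exact: integrableS imin.
- exact: integrableS iq.
- by move=> x _; rewrite ge_min lexx orbT.
Qed.

(** * Measurable nearest-point selection *)

(** Sublevel sets of the distance to m are open balls, and half-lines ]-oo, c[
    generate the Borel sets of the line. *)
Lemma measurable_mdist_estimator d (X : measurableType d) (R : realType)
    (M : metricType R) (T : X -> M) (m : M) :
  estimator T -> measurable_fun setT (fun x => mdist (T x) m).
Proof.
move=> mT _; apply: (measurability _ (RGenInftyO.measurableE R)) => //.
move=> _ [_ [c ->] <-]; rewrite setTI.
rewrite [X in measurable X](_ : _ = T @^-1` [set y | mdist y m < c]%R).
  apply: mT; rewrite openE => y /= ymc; rewrite /interior.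
  apply/nbhs_ballP; exists (c - mdist y m)%R; rewrite /= ?subr_gt0//.
  move=> z; rewrite ballEmdist/= ltrBrDr => yz; apply: le_lt_trans yz.
  by rewrite (metric_sym y z) metric_triangle.
by apply/seteqP; split => x /=; rewrite in_itv.
Qed.

Lemma measurable_preimage_finType d (X : measurableType d) (K : finType)
    (g : X -> K) (S : set K) :
  (forall k, measurable (g @^-1` [set k])) -> measurable (g @^-1` S).
Proof.
move=> mg; rewrite (_ : g @^-1` S = \bigcup_(k in S) (g @^-1` [set k])).
  by apply: fin_bigcup_measurable; first exact: finite_finset.
by apply/seteqP; split => [x Sgx|x [k Sk /= ->]//]; exists (g x).
Qed.

(** The choice among the minimisers depends on x only through the finite table
    of comparisons f j x <= f k x, each cell of which is measurable in x; with
    ties broken by a function of this table, every event about the selected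
    index is a finite union of events about the table. *)
Lemma measurable_argmin d (X : measurableType d) (R : realType)
    (K : finType) (k0 : K) (f : K -> X -> R) :
  (forall k, measurable_fun setT (f k)) ->
  exists g : X -> K, (forall S : set K, measurable (g @^-1` S)) /\
    forall x k, (f (g x) x <= f k x)%R.
Proof.
move=> mf.
pose cmp x : {ffun K * K -> bool} := [ffun jk => f jk.1 x <= f jk.2 x]%R.
pose first_min (b : {ffun K * K -> bool}) : K :=
  odflt k0 [pick k | [forall l, b (k, l)]].
have mcmp : forall b, measurable (cmp @^-1` [set b]).
  move=> b; rewrite (_ : cmp @^-1` [set b] =
    \bigcap_(jk in [set: K * K]) [set x | (f jk.1 x <= f jk.2 x)%R = b jk]).
    apply: fin_bigcap_measurable; first exact: finite_finset.
    move=> [j k] _ /=.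
    have mle : measurable [set x | (f j x <= f k x)%R].
      by rewrite -[X in measurable X]setTI; exact: measurable_fun_le.
    case: (b (j, k)) => //.
    rewrite (_ : [set x | _] = ~` [set x | (f j x <= f k x)%R]).
      exact: measurableC.
    by apply/seteqP; split => x /=; [move/negbT/negP|move/negP/negbTE].
  apply/seteqP; split => [x <- jk _|x xb] /=; first by rewrite ffunE.
  by apply/ffunP => jk; rewrite ffunE; exact: xb.
exists (first_min \o cmp); split => [S|x k].
  exact: (measurable_preimage_finType (first_min @^-1` S) mcmp).
(* The default k0 is never used: a finite family always has a minimum. *)
rewrite /first_min /=; case: pickP => [j /forallP/(_ k)|]; first by rewrite ffunE.
have [j _ jmin] := @arg_minP _ _ _ k0 xpredT (f^~ x) isT.
by move=> /(_ j)/negP[]; apply/forallP => l; rewrite ffunE jmin.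
Qed.

(** * Losses and errors on the hypercube *)

Section hypercube.
Context (R : realType) (r p : nat) (B : {fset 'rV[R]_p}).
Context (Lambda : {fset {ffun 'I_r -> B}}).

Lemma hammingE (g h : {ffun 'I_r -> bool}) :
  hamming R g h = (\sum_(i < r) (g i != h i)%:R)%R.
Proof.
apply: eq_bigr => i _.
by case: (g i); case: (h i); rewrite ?subrr ?subr0 ?sub0r ?normrN ?normr0 ?normr1.
Qed.

Lemma sum_param_slices (F : param Lambda -> \bar R) (i : 'I_r) :
  \sum_t F t = \sum_(t in param_slice Lambda i false) F t +
               \sum_(t in param_slice Lambda i true) F t.
Proof.
rewrite (bigID (fun t : param Lambda => t.1 i == false)) /=.
congr (_ + _); apply: eq_bigl => t; rewrite inE //.
by case: (t.1 i).
Qed.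

Section metric_target.
Context (M : metricType R) (psi : param Lambda -> M) (s : R).

Lemma alpha_ge0 : 0 <= alpha psi s.
Proof.
apply: le_bigmin => // tt h; rewrite lee_fin divr_ge0 ?powR_ge0//.
exact: le_trans h.
Qed.

(** Pairs of parameters at Hamming distance 0 are left out of the minimum
    defining alpha, but for them the left-hand side vanishes; the Hamming
    distance being an integer, no value lies strictly between 0 and 1. *)
Lemma alpha_hamming_le (t u : param Lambda) :
  alpha psi s * (hamming R t.1 u.1)%:E <= (mdist (psi t) (psi u) `^ s)%:E.
Proof.
have [h|h] := leP 1%R (hamming R t.1 u.1).
  have h0 : (0 < hamming R t.1 u.1)%R by exact: lt_le_trans h.
  apply: (@le_trans _ _ ((mdist (psi t) (psi u) `^ s / hamming R t.1 u.1)%:E *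
      (hamming R t.1 u.1)%:E)).
    apply: lee_wpmul2r; first by rewrite lee_fin ltW.
    exact: (@bigmin_le_cond _ _ _ _ (t, u)).
  by rewrite -EFinM divfK ?gt_eqF.
suff -> : hamming R t.1 u.1 = 0%R by rewrite mule0 lee_fin powR_ge0.
apply/eqP; move: h; rewrite hammingE -natr_sum.
by rewrite ltrn1 pnatr_eq0 ltnS leqn0.
Qed.

(** If n is at least as near to y as t, then psi n and psi t are within twice
    the distance from y to psi t: this is where the factor 2^s comes from. *)
Lemma nearest_loss_ge (y : M) (n t : param Lambda) :
  (0 <= s)%R ->
  (mdist y (psi n) <= mdist y (psi t))%R ->
  alpha psi s * (hamming R n.1 t.1)%:E <= (2 `^ s * mdist y (psi t) `^ s)%:E.
Proof.
move=> s0 nt; apply: le_trans (alpha_hamming_le n t) _.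
rewrite lee_fin -powRM ?mdist_ge0//; apply: ge0_ler_powR => //.
- by rewrite nnegrE mdist_ge0.
- by rewrite nnegrE mulr_ge0// mdist_ge0.
rewrite mulr_natl mulr2n; apply: le_trans (metric_triangle _ y _) _.
by rewrite lerD2r metric_sym.
Qed.

End metric_target.

Section experiment.
Context d (X : measurableType d) (P : param Lambda -> probability X R).

(** The binary statistic g errs on a parameter with i-th bit 0 when it takes the
    value 1, and conversely; the sum over a slice is the mixture times the
    cardinality of the slice. *)
Lemma sum_coordinate_errors (g : X -> bool) (i : 'I_r) :
  Lambda != fset0 ->
  \sum_t P t [set x | g x != t.1 i] =
  (2 ^ r.-1 * #|` Lambda|)%:R%:E *
    (mixture P i false [set x | g x] + mixture P i true (~` [set x | g x])).
Proof.
move=> L0; rewrite (sum_param_slices _ i) muleDr//; last first.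
  by rewrite ge0_adde_def ?inE.
have N0 : ((2 ^ r.-1 * #|` Lambda|)%:R != 0 :> R)%R.
  by rewrite pnatr_eq0 -lt0n muln_gt0 expn_gt0 cardfs_gt0.
rewrite /mixture !muleA -EFinM divff// !mul1e; congr (_ + _).
  apply: eq_bigr => t; rewrite inE => /eqP ti; congr (P t _).
  by apply/seteqP; split => x /=; rewrite ti; case: (g x).
apply: eq_bigr => t; rewrite inE => /eqP ti; congr (P t _).
by apply/seteqP; split => x /=; rewrite ti; case: (g x).
Qed.

Context (M : metricType R) (psi : param Lambda -> M) (s : R).

(** The expectation of [nearest_loss_ge], the expected Hamming distance being
    the sum over the coordinates of the probabilities of error. *)
Lemma risk_ge_errors (T : X -> M) (n : X -> param Lambda) (t : param Lambda) :
  (0 <= s)%R -> estimator T ->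
  (forall S : set (param Lambda), measurable (n @^-1` S)) ->
  (forall x u, mdist (T x) (psi (n x)) <= mdist (T x) (psi u))%R ->
  alpha psi s * \sum_(i < r) P t [set x | (n x).1 i != t.1 i] <=
  (2 `^ s)%:E * 'E_(P t)[fun x => (mdist (T x) (psi t) `^ s)%R].
Proof.
move=> s0 mT mn nmin.
have merr i : measurable [set x | (n x).1 i != t.1 i].
  exact: (mn [set u : param Lambda | u.1 i != t.1 i]).
have mind i : measurable_fun setT
    (fun x => (\1_[set x | (n x).1 i != t.1 i] x)%:E : \bar R).
  by apply/measurable_EFinP; exact: measurable_indic.
have mloss : measurable_fun setT (fun x => (mdist (T x) (psi t) `^ s)%R).
  apply: (@measurableT_comp _ _ _ _ _ _ (fun y : R => y `^ s)%R).
    exact: measurable_powR.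
  exact: measurable_mdist_estimator.
rewrite expectation.unlock -ge0_integralZl_EFin ?powR_ge0//; last 2 first.
- by move=> x _; rewrite lee_fin powR_ge0.
- exact/measurable_EFinP.
under eq_bigr => i _ do rewrite -[X in P t X]setIT -integral_indic//.
rewrite -ge0_integral_sum//.
rewrite -ge0_integralZl//; last 3 first.
- exact: emeasurable_sum.
- by move=> x _; rewrite sume_ge0// => i _; rewrite lee_fin.
- exact: alpha_ge0.
apply: ge0_le_integral => //.
- by move=> x _; rewrite mule_ge0 ?alpha_ge0// sume_ge0.
- by apply: measurable_funeM; exact: emeasurable_sum.
- by apply: measurable_funeM; exact/measurable_EFinP.
move=> x _; rewrite -EFinM; apply: le_trans (nearest_loss_ge s0 (nmin x t)).
rewrite hammingE sumEFin; under eq_bigr => i _ do rewrite indicE mem_setE.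
by [].
Qed.

End experiment.
End hypercube.

(** * The minimax lower bound *)

Theorem lemma3 (R : realType) (r p : nat) (hr : (0 < r)%N) (hp : (0 < p)%N)
  (B : {fset 'rV[R]_p}) (hB : 0%R \notin B)
  (Lambda : {fset {ffun 'I_r -> B}}) (hLambda : Lambda != fset0)
  (d : measure_display) (X : measurableType d)
  (P : param Lambda -> probability X R)
  (M : metricType R) (psi : param Lambda -> M)
  (s : R) (hs : (0 < s)%R) (T : X -> M) (hT : estimator T) :
  alpha psi s * (r%:R / 2)%:E *
    \big[Order.min/+oo]_(i < r)
      tv_affinity (mixture P i false) (mixture P i true)
  <= \big[Order.max/-oo]_(t : param Lambda)
       ((2 `^ s)%:E * 'E_(P t)[fun x => (mdist (T x) (psi t) `^ s)%R]).
Proof.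
set m := \big[Order.min/+oo]_(i < r) _.
pose risk t := (2 `^ s)%:E * 'E_(P t)[fun x => (mdist (T x) (psi t) `^ s)%R].
set worst := \big[Order.max/-oo]_(t : param Lambda) _.
pose N := (2 ^ r.-1 * #|` Lambda|)%N.
have N0 : (0 < N)%N by rewrite muln_gt0 expn_gt0 cardfs_gt0.
pose i0 : 'I_r := Ordinal hr.
have [t0 _] : exists t0 : param Lambda, t0 \in param_slice Lambda i0 true.
  by apply/card_gt0P; rewrite card_param_slice.
have risk0 t : 0 <= risk t.
  rewrite /risk expectation.unlock mule_ge0 ?lee_fin ?powR_ge0// integral_ge0// => x _.
  by rewrite lee_fin powR_ge0.
have worst0 : 0 <= worst by apply: le_trans (risk0 t0) _; exact: le_bigmax.
have [n [mn nmin]] := measurable_argmin t0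
  (fun t => measurable_mdist_estimator (psi t) hT).
(* There are 2 N parameters: two slices of N elements along coordinate i0. *)
have sum_risk : \sum_t risk t <= (2 * N)%:R%:E * worst.
  apply: (@le_trans _ _ (\sum_(t : param Lambda) worst)).
    by apply: lee_sum => t _; exact: le_bigmax.
  rewrite (sum_param_slices _ i0) !sumr_const !card_param_slice -/N.
  by rewrite mule_natl -mulrnDr addnn mul2n.
have errors i : N%:R%:E * m <= \sum_t P t [set x | (n x).1 i != t.1 i].
  rewrite (sum_coordinate_errors P (fun x => (n x).1 i))// -/N.
  apply: lee_wpmul2l; first by rewrite lee_fin.
  apply: le_trans (bigmin_le _ i _) _.
  apply: tv_affinity_le_test.
  exact: (mn [set u : param Lambda | u.1 i]).
have N20 : (0 < (2 * N)%:R :> R)%R by rewrite ltr0n muln_gt0.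
(* Multiplying by the number of parameters replaces averages by sums. *)
rewrite -(@lee_pmul2l _ (2 * N)%:R%:E)//.
apply: le_trans sum_risk.
apply: (@le_trans _ _ (\sum_t alpha psi s *
    \sum_(i < r) P t [set x | (n x).1 i != t.1 i])); last first.
  by apply: lee_sum => t _; apply: risk_ge_errors => //; exact: ltW.
rewrite -ge0_sume_distrr; last by move=> t _; exact: sume_ge0.
rewrite exchange_big /= -muleA muleCA; apply: lee_wpmul2l.
  exact: alpha_ge0.
have -> : ((2 * N)%:R%:E * ((r%:R / 2)%:E * m) = r%:R%:E * (N%:R%:E * m)).
  by rewrite !muleA -!EFinM natrM mulrC mulrA divfK ?pnatr_eq0.
apply: (@le_trans _ _ (\sum_(i < r) N%:R%:E * m)); last exact: lee_sum.
by rewrite mule_natl sumr_const card_ord.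
Qed.
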